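(* Let $e$ be a non-horizontal edge in $\mathcal{E}$. Let $\mathfrak{a},\mathfrak{b},\mathfrak{c},\mathfrak{d}$ be (complex) roots of $\mathcal{Q}(e^L)$, $\mathcal{Q}(e^R)$, $\mathcal{Q}(\hat e)$ and $\mathcal{Q}(e^-\oplus e^+)$, respectively. Then $$\mathcal{Z}(e)_{\mathfrak a}=0,\qquad\mathcal{Z}(e)_{\mathfrak b}=\infty,\qquad\mathcal{Z}(e)_{\mathfrak c}=1,\qquad\mathcal{Z}(e)_{\mathfrak d}=1.$$ Write $a/b$ and $c/d$ for the endpoints of $e$ (in lowest terms) and $\alpha=(cd-ab)/(d^2-b^2)$. If $\alpha\in(0,1/2)$, $1/\alpha\notin\mathbb{Z}$, and $\mathfrak{z}(\alpha)$ is the geometric root of $\mathcal{Q}(\alpha)$, then $$\mathcal{Z}(e)_{\mathfrak{z}(\alpha)}=-1.$$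
   Context: $\mathbb{Q}_0=\mathbb{Q}\cap[0,1]$, $\widehat{\mathbb{Q}}_0=\mathbb{Q}_0\cup\{\infty\}$; fractions are in lowest terms with positive denominator, $0=0/1$, $1=1/1$, $\infty=1/0$. A pair $\{p/q,r/s\}\subset\widehat{\mathbb{Q}}_0$ is a Farey pair if $ps-rq=\pm1$; $p/q\oplus r/s=(p+r)/(q+s)$; $\gamma\oplus^0\beta=\gamma$, $\gamma\oplus^j\beta=(\gamma\oplus^{j-1}\beta)\oplus\beta$. $\mathcal{E}$ is the set of Farey pairs $e\subset\mathbb{Q}_0$, with endpoints $e^L<e^R$. The edge $\{0,1\}$ is horizontal. For any other edge, $e^-$ and $e^+$ are the endpoints with smaller and larger denominator, $\hat e\in\mathbb{Q}_0$ is determined by $\hat e\oplus e^-=e^+$, and $\nu(e)=-1$ if $e^-=e^L$, $\nu(e)=1$ if $e^-=e^R$. $d_{\mathcal Q}(p/q)=(-1)^px^q$. $\mathcal{Q}:\widehat{\mathbb{Q}}_0\to\mathbb{Z}[x]$ is the unique function with $\mathcal{Q}(0)=1,\mathcal{Q}(\infty)=0,\mathcal{Q}(1)=1$ and $\mathcal{Q}(\gamma\oplus^2\beta)=-d_{\mathcal Q}(\beta)\mathcal{Q}(\gamma)+\mathcal{Q}(\beta)\mathcal{Q}(\gamma\oplus\beta)$ for every Farey pair $\{\beta,\gamma\}$ with $\gamma\oplus^2\beta\in\mathbb{Q}_0$. The shape parameter function is $\mathcal{Z}(e)=-d_{\mathcal Q}(\hat e)^{-\nu(e)}(\mathcal{Q}(e^L)/\mathcal{Q}(e^R))^2\in\mathbb{Q}(x)$.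 A subscript $\mathfrak{z}$ denotes evaluation at $x=\mathfrak z$, with values in $\mathbb{C}\cup\{\infty\}$ (numerator and denominator evaluated separately). Geometric root. For $\alpha\in\mathbb{Q}\cap(0,1/2)$ with $1/\alpha\notin\mathbb{Z}$, define edges $e_0,\dots,e_{n+1}$ (the funnel $F_\alpha$): $e_0=\{0,1\}$; given $e_j$, let $c=e_j^L\oplus e_j^R$; if $c=\alpha$ stop and set $j=n+1$; if $\alpha<c$ then $e_{j+1}=\{e_j^L,c\}$; if $\alpha>c$ then $e_{j+1}=\{c,e_j^R\}$. The geometric root $\mathfrak{z}(\alpha)$ of $\mathcal{Q}(\alpha)$ is the unique $\mathfrak{z}\in\mathbb{C}$ with $\operatorname{Im}\mathfrak z>0$, $\mathcal{Q}(\alpha)_{\mathfrak z}=0$ and $\operatorname{Im}\mathcal{Z}(e_j)_{\mathfrak z}>0$ for $1\le j\le n$ (it corresponds to the complete hyperbolic structure on the 2-bridge link complement $M_\alpha$). *)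

(* Defs.v *)
From mathcomp Require Import all_boot all_order all_algebra.
From mathcomp Require Import generic_quotient fraction.
From mathcomp Require Export complex.
From mathcomp Require Export reals.
From mathcomp Require Import ring lra zify.

Set Implicit Arguments.
Unset Strict Implicit.
Unset Printing Implicit Defensive.

Import Order.TTheory GRing.Theory Num.Theory.
Local Open Scope ring_scope.

(* Extended rationals: [Some r] is the rational r, [None] is oo = 1/0. *)
Notation xrat := (option rat).

Definition xnum (u : xrat) : int := if u is Some r then numq r else 1.
Definition xden (u : xrat) : int := if u is Some r then denq r else 0.
Definition xfrac (p q : int) : xrat :=
  if q == 0 then None else Some (p%:Q / q%:Q).

Definition inQ0 (r : rat) : bool := 0 <= r <= 1.
Definition xinQ0 (u : xrat) : bool := if u is Some r then inQ0 r else false.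
Definition inQ0hat (u : xrat) : bool := if u is Some r then inQ0 r else true.

Definition farey_pair (u v : xrat) : bool :=
  [&& inQ0hat u, inQ0hat v & `|xnum u * xden v - xnum v * xden u| == 1].

Definition oplus (u v : xrat) : xrat :=
  xfrac (xnum u + xnum v) (xden u + xden v).
Definition oplusn (g : xrat) (j : nat) (b : xrat) : xrat :=
  iter j (fun u => oplus u b) g.

Definition mediant (r s : rat) : rat :=
  (numq r + numq s)%:Q / (denq r + denq s)%:Q.

Lemma oplus_Some (r s : rat) : oplus (Some r) (Some s) = Some (mediant r s).
Proof.
by rewrite /oplus /xfrac /= gt_eqF // addr_gt0 ?denq_gt0.
Qed.

(* An edge e is the pair (e^L, e^R). *)
Definition edge : Type := (rat * rat)%type.
Definition is_edge (e : edge) : bool :=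
  farey_pair (Some e.1) (Some e.2) && (e.1 < e.2).
Definition horizontal : edge := (0, 1).

Definition eminus (e : edge) : rat :=
  if denq e.1 < denq e.2 then e.1 else e.2.
Definition eplus (e : edge) : rat :=
  if denq e.1 < denq e.2 then e.2 else e.1.
Definition nu (e : edge) : int := if denq e.1 < denq e.2 then -1 else 1.

(* The solution of [ehat (+) e^- = e^+]; see [ehatP]. *)
Definition ehat (e : edge) : rat :=
  (numq (eplus e) - numq (eminus e))%:Q / (denq (eplus e) - denq (eminus e))%:Q.

Definition dQ (u : xrat) : {poly int} :=
  (-1) ^+ `|xnum u|%N * 'X ^+ `|xden u|%N.

(* The values of [Q] outside Q0hat are unconstrained and never used. *)
Definition is_fareyQ (Q : xrat -> {poly int}) : Prop :=
  [/\ Q (Some 0) = 1, Q None = 0, Q (Some 1) = 1 &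
      forall b g : xrat, farey_pair b g -> xinQ0 (oplusn g 2 b) ->
        Q (oplusn g 2 b) = - dQ b * Q g + Q b * Q (oplus g b)].

Notation ratfun := {fraction {poly rat}}.
Definition to_ratfun (p : {poly int}) : ratfun :=
  FracField.tofrac (map_poly intr p).

Definition shape_param (Q : xrat -> {poly int}) (e : edge) : ratfun :=
  - to_ratfun (dQ (Some (ehat e))) ^ (- nu e)
  * (to_ratfun (Q (Some e.1)) / to_ratfun (Q (Some e.2))) ^+ 2.

Definition rf_num (f : ratfun) : {poly rat} :=
  let r := repr f in \n_r %/ gcdp \n_r \d_r.
Definition rf_den (f : ratfun) : {poly rat} :=
  let r := repr f in \d_r %/ gcdp \n_r \d_r.

(* Value of a rational function in C \cup {oo}, with [None] standing for oo:
   the numerator and denominator of a reduced fraction are evaluated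
   separately. *)
Definition rf_eval (R : realType) (f : ratfun) (z : R[i]) : option R[i] :=
  let n := (map_poly ratr (rf_num f)).[z] in
  let d := (map_poly ratr (rf_den f)).[z] in
  if d == 0 then None else Some (n / d).

Definition is_root (R : realType) (p : {poly int}) (z : R[i]) : Prop :=
  root (map_poly intr p) z.

(* False at oo. *)
Definition Im_pos (R : realType) (w : option R[i]) : Prop :=
  if w is Some w' then 0 < complex.Im w' else False.

Definition funnel_step (alpha : rat) (e : edge) : edge :=
  let c := mediant e.1 e.2 in
  if alpha < c then (e.1, c) else (c, e.2).
(* Only the values for j <= n+1, where [funnel_length alpha n], are
   meaningful. *)
Definition funnel (alpha : rat) (j : nat) : edge :=
  iter j (funnel_step alpha) horizontal.
Definition funnel_apex (alpha : rat) (j : nat) : rat :=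
  mediant (funnel alpha j).1 (funnel alpha j).2.
(* The funnel of alpha consists of the edges e_0, ..., e_(n+1). *)
Definition funnel_length (alpha : rat) (n : nat) : Prop :=
  funnel_apex alpha n.+1 = alpha /\
  forall j : nat, (j <= n)%N -> funnel_apex alpha j <> alpha.

Definition geometric_conditions (R : realType) (Q : xrat -> {poly int})
    (alpha : rat) (z : R[i]) : Prop :=
  [/\ 0 < complex.Im z,
      is_root (Q (Some alpha)) z &
      exists2 n : nat, funnel_length alpha n &
        forall j : nat, (1 <= j <= n)%N ->
          Im_pos (rf_eval (shape_param Q (funnel alpha j)) z)].

(* z is *the* solution of the geometric conditions. *)
Definition is_geometric_root (R : realType) (Q : xrat -> {poly int})
    (alpha : rat) (z : R[i]) : Prop :=
  unique (geometric_conditions Q alpha) z.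

Lemma ratfun_repr (f : ratfun) :
  f = FracField.tofrac \n_(repr f) / FracField.tofrac \d_(repr f).
Proof.
have dn0 : FracField.tofrac \d_(repr f) != 0.
  by rewrite tofrac_eq0 denom_ratioP.
apply: (canRL (mulfK dn0)); rewrite -{1}[f]reprK.
move: (repr f) => x; rewrite /GRing.mul /= !piE; apply/eqmodP.
rewrite /= FracField.equivfE /FracField.mulf.
by rewrite !numden_Ratio ?oner_eq0 ?mulr1 ?mulf_neq0 ?denom_ratioP // mulrC.
Qed.

Lemma rf_evalE (R : realType) (n d : {poly rat}) (z : R[i]) :
  coprimep n d -> d != 0 ->
  rf_eval (FracField.tofrac n / FracField.tofrac d) z =
  if (map_poly ratr d).[z] == 0 then None
  else Some ((map_poly ratr n).[z] / (map_poly ratr d).[z]).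
Proof.
move=> cop dn0; rewrite /rf_eval.
set f := _ / _; set n' := rf_num f; set d' := rf_den f.
have d0 := denom_ratioP (repr f).
have cop' : coprimep n' d' by apply: coprimep_div_gcd; rewrite d0 orbT.
have d'K : d' * gcdp \n_(repr f) \d_(repr f) = \d_(repr f).
  by rewrite divpK // dvdp_gcdr.
have n'K : n' * gcdp \n_(repr f) \d_(repr f) = \n_(repr f).
  by rewrite divpK // dvdp_gcdl.
have gn0 : gcdp \n_(repr f) \d_(repr f) != 0.
  by rewrite gcdp_eq0 negb_and d0 orbT.
have E : n * d' = n' * d.
  apply: (mulIf gn0); rewrite -mulrA d'K mulrAC n'K.
  have := ratfun_repr f; rewrite {1}/f => /eqP.
  rewrite eqr_div ?tofrac_eq0 // -!rmorphM tofrac_eq => /eqP ->.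
  by [].
have Ez : (map_poly ratr n).[z] * (map_poly ratr d').[z]
        = (map_poly ratr n').[z] * (map_poly ratr d).[z].
  by rewrite -!hornerM -!rmorphM E.
have nz (p q : {poly rat}) : coprimep p q ->
    (map_poly ratr q).[z] = 0 -> (map_poly ratr p).[z] != 0.
  move=> cpq q0; rewrite coprimep_sym in cpq.
  have : coprimep (map_poly ratr q) (map_poly (ratr : rat -> R[i]) p).
    by rewrite coprimep_map.
  by move/coprimep_root; apply; apply/rootP.
have [dz|dz] := eqVneq (map_poly ratr d).[z] 0.
  move: Ez; rewrite dz mulr0 => /eqP; rewrite mulf_eq0.
  by rewrite (negPf (nz _ _ cop dz)) => /= ->.
have [d'z|d'z] := eqVneq (map_poly ratr d').[z] 0.
  move: Ez; rewrite d'z mulr0 => /esym/eqP; rewrite mulf_eq0.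
  by rewrite (negPf (nz _ _ cop' d'z)) (negPf dz).
by congr Some; apply/eqP; rewrite eqr_div // Ez.
Qed.

Lemma numden_frac (p q a b : int) : 0 < q -> `|p * b - a * q| = 1 ->
  numq (p%:Q / q%:Q) = p /\ denq (p%:Q / q%:Q) = q.
Proof.
move=> q0 H.
have cop : coprime `|p| `|q|.
  have c1 : (gcdz p q %| p * b - a * q)%Z.
    apply: rpredB; first exact: dvdz_mulr (dvdz_gcdl p q).
    exact: dvdz_mull (dvdz_gcdr p q).
  have n1 : absz (p * b - a * q)%R = 1%N by lia.
  by move: c1; rewrite dvdzE n1 dvdn1 /gcdz absz_nat.
have qn0 : q != 0 by rewrite gt_eqF.
rewrite coprimeq_num // coprimeq_den // gtr0_sg // mul1r (negPf qn0).
by rewrite gtr0_norm.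
Qed.

Lemma ehatP (e : edge) : is_edge e -> e <> horizontal ->
  [/\ inQ0 (ehat e),
      farey_pair (Some (ehat e)) (Some (eminus e)) &
      oplus (Some (ehat e)) (Some (eminus e)) = Some (eplus e)].
Proof.
move=> he hne.
have bnd (r : rat) : inQ0 r -> 0 <= numq r <= denq r.
  move=> /andP[r0 r1]; rewrite numq_ge0 r0 /=.
  by move: r1; rewrite -{1}[r]divq_num_den ler_pdivrMr ?ltr0z ?denq_gt0 // mul1r ler_int.
have [hm hM hlt H] : [/\ inQ0 (eminus e), inQ0 (eplus e),
    denq (eminus e) < denq (eplus e) &
    `|numq (eplus e) * denq (eminus e) - numq (eminus e) * denq (eplus e)| = 1].
  move: he hne; case: e => r s /andP[/and3P[/= hr hs /eqP H] lt] hne.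
  rewrite /eminus /eplus /=; case: ltP => [hd|hd].
    by split=> //; rewrite -H distrC; congr `|_|; ring.
  have [E|ne] := eqVneq (denq s) (denq r); last first.
    split=> //; first by rewrite lt_neqAle ne hd.
  case: hne.
  have dr : denq r = 1.
    move: H; rewrite E -mulrBl normrM (gtr0_norm (denq_gt0 r)) => H.
    have : (denq r %| 1)%Z by apply/dvdzP; exists `|numq r - numq s|.
    by rewrite dvdz1 => /eqP dr; rewrite -(gtr0_norm (denq_gt0 r)) -abszE dr.
  have := bnd _ hr; have := bnd _ hs; rewrite E dr => b1 b2.
  have Er : r = (numq r)%:Q by rewrite -{1}[r]divq_num_den dr divr1.
  have Es : s = (numq s)%:Q by rewrite -{1}[s]divq_num_den E dr divr1.
  have lt' : numq r < numq s by rewrite -(ltr_int rat) -Er -Es.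
  have [r0 s1] : numq r = 0 /\ numq s = 1 by lia.
  by rewrite /horizontal Er Es r0 s1.
rewrite /ehat; move: (bnd _ hm) (bnd _ hM) (denq_gt0 (eminus e)).
set a := numq (eminus e) in H *; set b := denq (eminus e) in hlt H *.
set c := numq (eplus e) in H *; set d := denq (eplus e) in hlt H *.
move=> ha hc b0.
have q0 : 0 < d - b by rewrite subr_gt0.
have H' : `|(c - a) * b - a * (d - b)| = 1 by rewrite -H; congr `|_|; ring.
have [En Ed] := numden_frac q0 H'.
have pb : 0 <= c - a <= d - b.
  apply/andP; split; nia.
have hq0 : inQ0 ((c - a)%:Q / (d - b)%:Q).
  rewrite /inQ0 divr_ge0 ?ler0z ?(ltW q0) //=; last by case/andP: pb.
  by rewrite ler_pdivrMr ?ltr0z // mul1r ler_int; case/andP: pb.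
split=> //.
  by rewrite /farey_pair /inQ0hat hq0 hm /= En Ed -/a -/b H'.
by rewrite oplus_Some /mediant En Ed !subrK divq_num_den.
Qed.

(* Main.v *)
Require Import Defs.
From mathcomp Require Import all_boot all_order all_algebra.
From mathcomp Require Import fraction.
From mathcomp Require Import ring zify.

(** Write [u(v) = d(v) / Q(v)^2] for a vertex [v] of the Farey graph.  As [d]
    is multiplicative along Farey sums, the shape parameter of every edge [e]
    is [- u(e^R) / u(e^L)], whichever endpoint has the smaller denominator.
    If [c] is the Farey sum of [e^L] and [e^R], the recursion for [Q]
    preserves the Markov type equation
      [Q(c)^2 + d(e^L) Q(e^R)^2 + d(e^R) Q(e^L)^2 = Q(e^L) Q(e^R) Q(c)]
    ([markov_identity]): the two values of [Q] on the two sides of an edge are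
    the two roots of one quadratic equation.  Setting one of the three values
    of [Q] on a triangle equal to [0] leaves an equation that says that the
    shape parameter of the opposite edge is [1], which gives the third and
    fourth claims.  The first two only need that [Q(e^L)] and [Q(e^R)] have no
    common zero; a common zero other than [0] would propagate down to the edge
    [{0, 1}], where [Q] is [1], and [0] is never a zero because the constant
    term of every [Q] is [1].

    The last claim is a symmetry argument.  With [s = Q(c) / (Q(e^L) Q(e^R))]
    the triple [(u(e^L), u(e^R), s)] of an edge determines the triple of the
    next edge of a funnel by a rational map [step] that no longer mentions
    [Q].  Walking a funnel in the opposite direction exchanges the two roots
    of the quadratic equation, that is, [s] and [1 - s], and indeed
    [step t] is its own inverse up to this exchange ([step_flip_step]).  The
    walk for the parameter [z] starts at [(z, -z, 1)].  If [z] is a zero of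
    [Q(alpha)], it ends at the last edge of the funnel of [alpha] with [s = 0],
    hence, by the Markov equation, at [(z', -z', 0)]; reversed, this is the
    start of the walk for the parameter [z'].  So the sequence of pairs
    [(u(e^L), u(e^R))] for [z'] is that for [z] read backwards along the
    reversed sequence of turns ([local_state_reversal]).

    For [alpha] as in the theorem the sequence of turns is a palindrome
    ([apex_palindrome]): its middle turn crosses the triangle with vertices
    [e^-], [e^+] and [ehat], entering by [{ehat, e^-}] and leaving by
    [{ehat, e^+}].  Therefore [z'] satisfies the geometric conditions as soon
    as [z] does ([geometric_conditions_reversal]), and uniqueness of the
    geometric root forces [z' = z].  The walk is then symmetric about its
    middle, so [u(e^-) = u(e^+)], and the shape parameter of [e] is [-1]. *)

Set Implicit Arguments.
Unset Strict Implicit.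
Unset Printing Implicit Defensive.

Import Order.TTheory GRing.Theory Num.Theory.
Local Open Scope ring_scope.

(** * Paths in the Farey graph *)

Lemma ltr_numden (r s : rat) : (r < s) = (numq r * denq s < numq s * denq r).
Proof.
rewrite -{1}[r]divq_num_den -{1}[s]divq_num_den.
rewrite ltr_pdivrMr ?ltr0z ?denq_gt0 // mulrAC ltr_pdivlMr ?ltr0z ?denq_gt0 //.
by rewrite -!intrM ltr_int.
Qed.

Lemma inQ0_numden (r : rat) : inQ0 r = (0 <= numq r <= denq r).
Proof.
rewrite /inQ0 numq_ge0 -{2}[r]divq_num_den ler_pdivrMr ?ltr0z ?denq_gt0 //.
by rewrite mul1r ler_int.
Qed.

Lemma is_edgeP (e : edge) : is_edge e <->
  [/\ inQ0 e.1, inQ0 e.2 &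
      numq e.2 * denq e.1 - numq e.1 * denq e.2 = 1].
Proof.
rewrite /is_edge /farey_pair /= ltr_numden; split.
  by case/andP=> /and3P[-> -> /eqP H] lt; split=> //; lia.
case=> -> -> H /=; apply/andP; split; last by lia.
by apply/eqP; lia.
Qed.

Lemma mediant_numden (e : edge) : is_edge e ->
  numq (mediant e.1 e.2) = numq e.1 + numq e.2 /\
  denq (mediant e.1 e.2) = denq e.1 + denq e.2.
Proof.
case/is_edgeP => _ _ H.
apply: (@numden_frac _ _ (numq e.1) (denq e.1)).
  by rewrite addr_gt0 ?denq_gt0.
by move: H; set a := numq _; set b := denq _; set c := numq _; set d := denq _;
  lia.
Qed.

Lemma mediant_between (e : edge) : is_edge e ->
  e.1 < mediant e.1 e.2 < e.2.
Proof.
move=> he; have [En Ed] := mediant_numden he.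
rewrite !ltr_numden En Ed; case/is_edgeP: he => _ _ H.
by apply/andP; split; move: H; lia.
Qed.

(** Crossing the triangle on [e] and its Farey sum: [left] keeps the left
    endpoint. *)
Definition turn (left : bool) (e : edge) : edge :=
  let c := mediant e.1 e.2 in if left then (e.1, c) else (c, e.2).

(** The latest turn is the head of the list: the suffixes of [w] are then the
    edges of the path that leads to [path_edge w], and the induction principle
    of lists is induction along paths. *)
Definition path_edge (w : seq bool) : edge := foldr turn horizontal w.

Lemma is_edge_turn (t : bool) (e : edge) : is_edge e -> is_edge (turn t e).
Proof.
move=> he; have [En Ed] := mediant_numden he.
have /andP[lc cr] := mediant_between he.
case/is_edgeP: he => /andP[l0 l1] /andP[r0 r1] H.
have cQ : inQ0 (mediant e.1 e.2).
  by rewrite /inQ0 (le_trans l0 (ltW lc)) (le_trans (ltW cr) r1).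
apply/is_edgeP; case: t => /=; rewrite En Ed; split=> //;
  by rewrite /inQ0 ?l0 ?r0 //; move: H; lia.
Qed.

Lemma is_edge_foldr (w : seq bool) (e : edge) :
  is_edge e -> is_edge (foldr turn e w).
Proof. by move=> he; elim: w => //= t w; apply: is_edge_turn. Qed.

Lemma is_edge_path (w : seq bool) : is_edge (path_edge w).
Proof. exact: is_edge_foldr. Qed.

Lemma foldr_turn_within (w : seq bool) (e : edge) : is_edge e ->
  e.1 <= (foldr turn e w).1 /\ (foldr turn e w).2 <= e.2.
Proof.
move=> he; elim: w => //= t w [l r].
have /andP[/ltW lc /ltW cr] := mediant_between (is_edge_foldr w he).
by case: t; split=> //=; [apply: le_trans r | apply: le_trans lc].
Qed.

Lemma mediantC (r s : rat) : mediant r s = mediant s r.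
Proof. by rewrite /mediant addrC [denq r + _]addrC. Qed.

(** Descent on denominators: [e] arises by one turn from the edge with
    endpoints [ehat e] and [e^-]. *)
Lemma path_edge_surj (e : edge) : is_edge e -> exists w, e = path_edge w.
Proof.
have [m] := ubnP (`|denq e.1| + `|denq e.2|)%N; elim: m e => // m IH e hm he.
case: (e =P horizontal) => [-> | hne]; first by exists [::].
have [hQ /and3P[_ _ /eqP hdet]] := ehatP he hne.
rewrite oplus_Some => -[hplus].
have [hnum hden] : numq (eplus e) = numq (ehat e) + numq (eminus e) /\
    denq (eplus e) = denq (ehat e) + denq (eminus e).
  rewrite -hplus; apply: (@numden_frac _ _ (numq (ehat e)) (denq (ehat e))).
    by rewrite addr_gt0 ?denq_gt0.
  by move: hdet => /= hdet; lia.
have h0 := denq_gt0 (ehat e); have l0 := denq_gt0 e.1; have r0 := denq_gt0 e.2.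
pose e' := if denq e.1 < denq e.2 then (e.1, ehat e) else (ehat e, e.2).
have he' : is_edge e'.
  case/is_edgeP: (he) => l01 r01 H.
  apply/is_edgeP; rewrite /e'; move: hnum hden; rewrite /eminus /eplus.
  by case: ifP => _ hn hd; split=> //=; lia.
have E : e = turn (denq e.1 < denq e.2) e'.
  rewrite /e' /turn; move: hplus; rewrite /eminus /eplus; case: ifP => _ /= E.
    by rewrite mediantC E -surjective_pairing.
  by rewrite E -surjective_pairing.
have [|w Ew] := IH e' _ he'.
  rewrite /e'; move: hden; rewrite /eminus /eplus.
  by case: ifP => _ /= hd; lia.
by exists ((denq e.1 < denq e.2) :: w); rewrite /= -Ew -E.
Qed.

Definition apex (e : edge) : rat := mediant e.1 e.2.

(** The intervals of a path are nested, so the turn that a path takes at one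
    of its edges is read off from the position of its last apex. *)
Lemma apex_drop (w : seq bool) (k : nat) : (k < size w)%N ->
  if nth true w k then apex (path_edge w) < apex (path_edge (drop k.+1 w))
  else apex (path_edge (drop k.+1 w)) < apex (path_edge w).
Proof.
move=> hk; set v := drop k.+1 w; set t := nth true w k.
have [lw wr] := foldr_turn_within (take k w) (is_edge_turn t (is_edge_path v)).
have /andP[la ar] := mediant_between (is_edge_path w).
have E : path_edge w = foldr turn (turn t (path_edge v)) (take k w).
  rewrite -[w in LHS](cat_take_drop k) (drop_nth true hk) /path_edge.
  exact: foldr_cat.
move: lw wr; rewrite -E; case: t {E} => /= lw wr.
  exact: lt_le_trans ar wr.
exact: le_lt_trans lw la.
Qed.

Lemma funnel_path (w : seq bool) (j : nat) : (j <= size w)%N ->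
  funnel (apex (path_edge w)) j = path_edge (drop (size w - j) w).
Proof.
elim: j => [_ | j IH hj]; first by rewrite subn0 drop_size.
rewrite /funnel iterS -/(funnel _ j) IH 1?ltnW //.
have hk : (size w - j.+1 < size w)%N by lia.
have -> : (size w - j = (size w - j.+1).+1)%N by lia.
rewrite [drop (_ - j.+1) w](drop_nth true hk).
have := apex_drop hk; rewrite /funnel_step /= /turn -/(apex _).
by case: (nth _ _ _) => [-> | /ltW]; rewrite // leNgt => /negPf ->.
Qed.

Lemma funnel_apex_neq (w : seq bool) (j : nat) : (j < size w)%N ->
  funnel_apex (apex (path_edge w)) j <> apex (path_edge w).
Proof.
move=> hj; rewrite /funnel_apex funnel_path 1?ltnW // -/(apex _).
have hk : (size w - j.+1 < size w)%N by lia.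
have -> : (size w - j = (size w - j.+1).+1)%N by lia.
by have := apex_drop hk; case: ifP => _ lt E; rewrite E ltxx in lt.
Qed.

Lemma funnel_length_path (w : seq bool) (n : nat) : (0 < size w)%N ->
  funnel_length (apex (path_edge w)) n <-> n.+1 = size w.
Proof.
have last_apex : funnel_apex (apex (path_edge w)) (size w) = apex (path_edge w).
  by rewrite /funnel_apex funnel_path // subnn drop0.
move=> w0; split=> [[hn hlt] | En].
  apply/eqP; rewrite eqn_leq; apply/andP; split; last first.
    by rewrite leqNgt; apply/negP => /funnel_apex_neq; apply.
  rewrite ltnNge; apply/negP => hle.
  by apply: (hlt (size w) hle).
split; first by rewrite En.
by move=> j hj; apply: funnel_apex_neq; rewrite -En ltnS.
Qed.

(** With [e = path_edge (t :: w)], the edge [path_edge w] joins [ehat e] and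
    [e^-], and the turn [~~ t] from it leads to the edge joining [ehat e] and
    [e^+]. *)
Definition palindrome_through (t : bool) (w : seq bool) : seq bool :=
  rev w ++ ~~ t :: w.

Lemma palindrome_throughK t w :
  rev (palindrome_through t w) = palindrome_through t w.
Proof. by rewrite /palindrome_through rev_cat rev_cons revK -cats1 -catA. Qed.

(** Turns act on the two endpoints as the matrices [[1,1],[0,1]] and
    [[1,0],[1,1]].  Reversing a product of them is transposition conjugated by
    the exchange of the two coordinates; so the coordinates of the apex that
    [rev w] reaches from [e] are the denominators of [path_edge w], in the
    opposite order. *)
Lemma apex_reverse_path (w : seq bool) (e : edge) : is_edge e ->
  let f := foldr turn e (rev w) in
  let b := denq (path_edge w).1 in let d := denq (path_edge w).2 in
  numq (apex f) = d * numq e.1 + b * numq e.2 /\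
  denq (apex f) = d * denq e.1 + b * denq e.2.
Proof.
elim: w e => [|t w IH] e he /=.
  by rewrite !mul1r; apply: mediant_numden.
rewrite rev_cons -cats1 foldr_cat /=.
have [-> ->] := IH _ (is_edge_turn t he).
have [En Ed] := mediant_numden he.
have [_ Ewd] := mediant_numden (is_edge_path w).
by case: t => /=; rewrite En Ed Ewd; split; ring.
Qed.

Lemma apex_palindrome (t : bool) (w : seq bool) :
  let e := path_edge (t :: w) in
  apex (path_edge (palindrome_through t w)) =
  (numq e.2 * denq e.2 - numq e.1 * denq e.1)%:Q
    / (denq e.2 ^+ 2 - denq e.1 ^+ 2)%:Q.
Proof.
move=> e; rewrite -[LHS]divq_num_den.
rewrite /palindrome_through /path_edge foldr_cat -/(path_edge _).
have he := is_edge_path w.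
have [-> ->] := apex_reverse_path w (is_edge_turn (~~ t) he).
have [En Ed] := mediant_numden he.
have b0 := denq_gt0 (path_edge w).1; have d0 := denq_gt0 (path_edge w).2.
rewrite /e /=; case: t {e} => /=; rewrite En Ed.
  by congr (_%:Q / _%:Q); ring.
have opp (n m : int) : n%:Q / m%:Q = (- n)%:Q / (- m)%:Q.
  by rewrite !intrN invrN mulrNN.
by rewrite [RHS]opp; congr (_%:Q / _%:Q); ring.
Qed.

(** * The Markov type equation *)

Lemma dQ_mediant (e : edge) : is_edge e ->
  dQ (Some (mediant e.1 e.2)) = dQ (Some e.1) * dQ (Some e.2).
Proof.
move=> he; have [En Ed] := mediant_numden he.
case/is_edgeP: he => l01 r01 _.
move: l01 r01; rewrite !inQ0_numden => /andP[n1 _] /andP[n2 _].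
have d1 := denq_gt0 e.1; have d2 := denq_gt0 e.2.
rewrite /dQ /= En Ed.
have -> : absz (numq e.1 + numq e.2)%R = (`|numq e.1| + `|numq e.2|)%N by lia.
have -> : absz (denq e.1 + denq e.2)%R = (`|denq e.1| + `|denq e.2|)%N by lia.
by rewrite !exprD mulrACA.
Qed.

Lemma Q_mediant (Q : option rat -> {poly int}) (hQ : is_fareyQ Q)
    (t : bool) (e : edge) : is_edge e ->
  Q (Some (apex (turn t e))) =
    - dQ (Some (if t then e.1 else e.2)) * Q (Some (if t then e.2 else e.1))
    + Q (Some (if t then e.1 else e.2)) * Q (Some (apex e)).
Proof.
move=> he; have [_ _ _ rec] := hQ.
have het := is_edge_turn t he.
have inQ := is_edge_turn true het; case/is_edgeP: inQ => _ inQ _.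
have E : Some (apex (turn t e)) =
    oplusn (Some (if t then e.2 else e.1)) 2 (Some (if t then e.1 else e.2)).
  rewrite /oplusn /= !oplus_Some /apex /turn; case: t {het inQ} => //=.
  by rewrite mediantC [mediant e.2 _]mediantC.
rewrite [in LHS]E rec; last first.
- by rewrite -E.
- case/is_edgeP: he => l01 r01 H.
  by rewrite /farey_pair; case: (t) => /=; rewrite l01 r01 /=; apply/eqP;
    move: H; lia.
congr (_ + _ * Q _); rewrite /= oplus_Some /apex.
by case: (t); rewrite // mediantC.
Qed.

(** The recursion at the pair [{0, oo}]: [1/2] is [oo] plus twice [0]. *)
Lemma Q_half (Q : option rat -> {poly int}) (hQ : is_fareyQ Q) :
  Q (Some (mediant 0 1)) = 1.
Proof.
have [Q0 Qoo Q1 rec] := hQ.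
have E : oplusn None 2 (Some 0) = Some (mediant 0 1).
  rewrite mediantC /oplusn /=.
  by have -> : oplus None (Some 0) = Some 1; rewrite ?oplus_Some.
by rewrite -E rec ?E // Qoo Q0 mulr0 add0r mul1r.
Qed.

(** The equation is quadratic in [p * y] once it is multiplied by [p]; the
    sum of its roots is [x * s], so the second root is [- p * y + x * s]. *)
Lemma markov_flip (A : comNzRingType) (p q x y s : A) :
  s ^+ 2 + p * y ^+ 2 + q * x ^+ 2 = x * y * s ->
  (- p * y + x * s) ^+ 2 + p * s ^+ 2 + p * q * x ^+ 2
  = x * s * (- p * y + x * s).
Proof.
move=> H; apply/eqP; rewrite -subr_eq0.
have -> : (- p * y + x * s) ^+ 2 + p * s ^+ 2 + p * q * x ^+ 2
    - x * s * (- p * y + x * s)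
  = p * (s ^+ 2 + p * y ^+ 2 + q * x ^+ 2 - x * y * s) by ring.
by rewrite H subrr mulr0.
Qed.

Lemma markov_identity (Q : option rat -> {poly int}) (hQ : is_fareyQ Q)
    (w : seq bool) :
  let e := path_edge w in
  Q (Some (apex e)) ^+ 2 + dQ (Some e.1) * Q (Some e.2) ^+ 2
    + dQ (Some e.2) * Q (Some e.1) ^+ 2
  = Q (Some e.1) * Q (Some e.2) * Q (Some (apex e)).
Proof.
elim: w => [|t w /= IH].
  have [Q0 _ Q1 _] := hQ.
  rewrite /path_edge /apex /= Q_half // Q0 Q1 /dQ /= expr1n !mulr1 mul1r.
  by rewrite expr1 mulN1r -addrA subrr addr0.
rewrite /= Q_mediant ?is_edge_path //.
have := dQ_mediant (is_edge_path w); rewrite -/(path_edge w).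
move: IH; rewrite /turn -/(apex _); case: t => /= IH ->.
  exact: markov_flip.
rewrite addrAC [dQ _ * dQ _]mulrC [Q (Some (apex _)) * Q _]mulrC.
by apply: markov_flip; rewrite addrAC [Q (Some (path_edge w).2) * Q _]mulrC.
Qed.

(** * Values of Q *)

Definition value (F : fieldType) (z : F) (p : {poly int}) : F :=
  (map_poly intr p).[z].

Lemma valueD (F : fieldType) (z : F) p q :
  value z (p + q) = value z p + value z q.
Proof. by rewrite /value rmorphD hornerD. Qed.

Lemma valueN (F : fieldType) (z : F) p : value z (- p) = - value z p.
Proof. by rewrite /value rmorphN hornerN. Qed.

Lemma valueM (F : fieldType) (z : F) p q :
  value z (p * q) = value z p * value z q.
Proof. by rewrite /value rmorphM hornerM. Qed.

Lemma value1 (F : fieldType) (z : F) : value z 1 = 1.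
Proof. by rewrite /value rmorph1 hornerE. Qed.

Lemma valueX (F : fieldType) (z : F) p n : value z (p ^+ n) = value z p ^+ n.
Proof. by rewrite /value rmorphXn horner_exp. Qed.

Definition valueE := (valueD, valueN, valueM, value1, valueX).

Lemma value_dQ (F : fieldType) (z : F) (r : rat) :
  value z (dQ (Some r)) = (-1) ^+ `|numq r| * z ^+ `|denq r|.
Proof. by rewrite /dQ !valueE /value map_polyX hornerX. Qed.

Lemma value_dQ_neq0 (F : fieldType) (z : F) (r : rat) : z != 0 ->
  value z (dQ (Some r)) != 0.
Proof.
by move=> z0; rewrite value_dQ mulf_neq0 ?expf_neq0 // oppr_eq0 oner_eq0.
Qed.

Lemma value_dQ_apex (F : fieldType) (z : F) (e : edge) : is_edge e ->
  value z (dQ (Some (apex e)))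
  = value z (dQ (Some e.1)) * value z (dQ (Some e.2)).
Proof. by move=> he; rewrite /apex dQ_mediant // valueM. Qed.

Lemma value_Q_turn (Q : option rat -> {poly int}) (hQ : is_fareyQ Q)
    (F : fieldType) (z : F) (t : bool) (e : edge) : is_edge e ->
  value z (Q (Some (apex (turn t e)))) =
    - value z (dQ (Some (if t then e.1 else e.2)))
      * value z (Q (Some (if t then e.2 else e.1)))
    + value z (Q (Some (if t then e.1 else e.2))) * value z (Q (Some (apex e))).
Proof.
move=> he; rewrite Q_mediant // valueD [value z (- _ * _)]valueM valueN.
by rewrite [value z (Q _ * _)]valueM.
Qed.

Lemma value_markov (Q : option rat -> {poly int}) (hQ : is_fareyQ Q)
    (F : fieldType) (z : F) (w : seq bool) :
  let e := path_edge w in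
  let x := value z (Q (Some e.1)) in let y := value z (Q (Some e.2)) in
  let s := value z (Q (Some (apex e))) in
  s ^+ 2 + value z (dQ (Some e.1)) * y ^+ 2 + value z (dQ (Some e.2)) * x ^+ 2
  = x * y * s.
Proof. by rewrite /= -!valueX -!valueM -!valueD markov_identity. Qed.

(** The constant terms: at [0] the recursion loses its first summand. *)
Lemma value0_Q (Q : option rat -> {poly int}) (hQ : is_fareyQ Q)
    (F : fieldType) (w : seq bool) :
  let e := path_edge w in
  [/\ value (0 : F) (Q (Some e.1)) = 1, value (0 : F) (Q (Some e.2)) = 1 &
      value (0 : F) (Q (Some (apex e))) = 1].
Proof.
elim: w => [|t w [/= x1 y1 s1]].
  by have [Q0 _ Q1 _] := hQ; rewrite /apex /= Q_half // Q0 Q1 value1.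
have d0 r : value (0 : F) (dQ (Some r)) = 0.
  by rewrite value_dQ expr0n absz_eq0 gt_eqF ?denq_gt0 ?mulr0.
have s'1 : value (0 : F) (Q (Some (apex (turn t (path_edge w))))) = 1.
  rewrite value_Q_turn ?is_edge_path // d0 oppr0 mul0r add0r s1 mulr1.
  by case: (t).
by move: s'1; rewrite /= /turn; case: t => /= ->.
Qed.

(** By the Markov equation two zeros on a triangle force the third one, so a
    common zero at an edge would be one at the preceding edge as well, down to
    [{0, 1}]. *)
Lemma Q_neighbours_coprime (Q : option rat -> {poly int}) (hQ : is_fareyQ Q)
    (F : fieldType) (z : F) (w : seq bool) : z != 0 ->
  value z (Q (Some (path_edge w).1)) = 0 ->
  value z (Q (Some (path_edge w).2)) != 0.
Proof.
move=> z0; elim: w => [|t w /= IH].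
  by have [-> _ _ _] := hQ; rewrite value1 => /eqP; rewrite oner_eq0.
have := value_markov hQ z w; have dn0 r := value_dQ_neq0 r z0.
rewrite /turn -/(apex _); case: t => /=.
  move=> M x0; apply/eqP => s0; move: (IH x0).
  move: M; rewrite x0 s0 !mul0r expr0n /= mulr0 addr0 add0r => /eqP.
  by rewrite mulf_eq0 (negPf (dn0 _)) /= expf_eq0 /= => ->.
move=> M s0; apply/eqP => y0; move: (IH); rewrite y0 eqxx => IH'.
move: M; rewrite y0 s0 mulr0 expr0n /= mulr0 !add0r => /eqP.
by rewrite mulf_eq0 (negPf (dn0 _)) /= expf_eq0 /= => /eqP /IH'.
Qed.

(** * Values of the shape parameter *)

Lemma to_ratfunM p q : to_ratfun (p * q) = to_ratfun p * to_ratfun q.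
Proof. by rewrite /to_ratfun !rmorphM. Qed.

Lemma to_ratfunX p n : to_ratfun (p ^+ n) = to_ratfun p ^+ n.
Proof. by rewrite /to_ratfun !rmorphXn. Qed.

Lemma to_ratfunN p : to_ratfun (- p) = - to_ratfun p.
Proof. by rewrite /to_ratfun !rmorphN. Qed.

(** The fraction need not be reduced: a common factor of [n] and [d] that
    does not vanish at [z] cancels. *)
Lemma rf_eval_to_ratfun (R : realType) (n d : {poly int}) (z : R[i]) :
  d != 0 -> (value z d = 0 -> value z n != 0) ->
  rf_eval (to_ratfun n / to_ratfun d) z =
  if value z d == 0 then None else Some (value z n / value z d).
Proof.
move=> d0 nz.
have pd0 : map_poly intr d != 0 :> {poly rat}.
  by rewrite map_poly_eq0_id0 ?intr_eq0 ?lead_coef_eq0.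
have valE (p : {poly int}) :
    (map_poly ratr (map_poly intr p : {poly rat})).[z] = value z p.
  rewrite /value -map_poly_comp; congr (_.[z]); apply: eq_map_poly => k /=.
  by rewrite ratr_int.
move: (valE n) (valE d); set pn := map_poly _ n.
set pd := map_poly _ d in pd0 *.
pose g := gcdp pn pd; pose n' := pn %/ g; pose d' := pd %/ g.
have g0 : g != 0 by rewrite gcdp_eq0 negb_and pd0 orbT.
have nE : pn = n' * g by rewrite divpK ?dvdp_gcdl.
have dE : pd = d' * g by rewrite divpK ?dvdp_gcdr.
have d'0 : d' != 0 by apply: contraNneq pd0 => d'0; rewrite dE d'0 mul0r.
have cop : coprimep n' d' by apply: coprimep_div_gcd; rewrite pd0 orbT.
have -> : to_ratfun n / to_ratfun d
    = FracField.tofrac n' / FracField.tofrac d'.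
  rewrite /to_ratfun -/pn -/pd nE dE !rmorphM -mulf_div divff ?mulr1 //.
  by rewrite tofrac_eq0.
rewrite rf_evalE // nE dE !rmorphM !hornerM => nV dV.
have gz : (map_poly ratr g).[z] != 0.
  by apply/eqP => gz; move: nz; rewrite -nV -dV gz !mulr0 eqxx => /(_ erefl).
rewrite -nV -dV mulf_eq0 (negPf gz) orbF.
by rewrite -mulf_div divff // mulr1.
Qed.

Lemma ehat_turn (t : bool) (e : edge) : is_edge e ->
  ehat (turn t e) = if t then e.2 else e.1.
Proof.
move=> he; have [En Ed] := mediant_numden he.
have d1 := denq_gt0 e.1; have d2 := denq_gt0 e.2.
rewrite /ehat /eplus /eminus /turn; case: t => /=; rewrite Ed.
  have -> : denq e.1 < denq e.1 + denq e.2 by lia.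
  by rewrite En Ed ![_ + _ e.2]addrC !addrK divq_num_den.
have -> : (denq e.1 + denq e.2 < denq e.2) = false by lia.
by rewrite En Ed !addrK divq_num_den.
Qed.

Lemma nu_turn (t : bool) (e : edge) : is_edge e ->
  nu (turn t e) = if t then -1 else 1.
Proof.
move=> he; have [En Ed] := mediant_numden he.
have d1 := denq_gt0 e.1; have d2 := denq_gt0 e.2.
by rewrite /nu /turn; case: t => /=; rewrite Ed; case: ifP => //; lia.
Qed.

(** [ehat] is the endpoint that the turn drops, and the power of its [dQ] is
    in both cases the quotient of the [dQ] of the right by that of the left
    endpoint. *)
Lemma shape_param_turn (Q : option rat -> {poly int}) (t : bool) (e : edge) :
  is_edge e -> let c := apex e in
  shape_param Q (turn t e) =
  if t then to_ratfun (- (dQ (Some e.2) * Q (Some e.1) ^+ 2))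
            / to_ratfun (Q (Some c) ^+ 2)
  else to_ratfun (- Q (Some c) ^+ 2)
       / to_ratfun (dQ (Some e.1) * Q (Some e.2) ^+ 2).
Proof.
move=> he c; rewrite /shape_param ehat_turn // nu_turn // expr_div_n.
have [dl dr] := (to_ratfunM (dQ (Some e.1)), to_ratfunM (dQ (Some e.2))).
case: t; rewrite /= -/(apex e) -/c !to_ratfunN ?dl ?dr !to_ratfunX.
  by rewrite opprK expr1z mulrA !mulNr.
by rewrite exprN1 [in RHS]invfM !mulNr mulrCA.
Qed.

(** The common factor [dQ] of an endpoint of [path_edge w], present in this
    form of the quotient, makes the formula independent of [t]. *)
Lemma rf_eval_shape (R : realType) (Q : option rat -> {poly int})
    (hQ : is_fareyQ Q) (z : R[i]) (t : bool) (w : seq bool) : z != 0 ->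
  let e := path_edge (t :: w) in
  let x := value z (Q (Some e.1)) in let y := value z (Q (Some e.2)) in
  rf_eval (shape_param Q e) z =
  if y == 0 then None else
  Some (- (value z (dQ (Some e.2)) * x ^+ 2)
        / (value z (dQ (Some e.1)) * y ^+ 2)).
Proof.
move=> z0 /=; have he := is_edge_path w.
have dn0 r := value_dQ_neq0 r z0.
have Qn0 r : value (0 : R[i]) (Q (Some r)) = 1 -> Q (Some r) != 0.
  move=> v1; apply: contra_eq_neq v1 => ->.
  by rewrite /value rmorph0 horner0 eq_sym oner_eq0.
have [_ /Qn0 Qy0 _] := value0_Q hQ R[i] (t :: w).
have cop : value z (Q (Some (path_edge (t :: w)).2)) == 0 ->
    value z (Q (Some (path_edge (t :: w)).1)) != 0.
  move=> /eqP y0; apply/eqP => /(Q_neighbours_coprime hQ z0).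
  by rewrite y0 eqxx.
have canc (p a b : R[i]) : p != 0 -> (p * a) / (p * b) = a / b.
  by move=> p0; rewrite -mulf_div divff ?mul1r.
rewrite shape_param_turn //; case: t Qy0 cop => /= Qy0 cop.
  rewrite rf_eval_to_ratfun ?expf_neq0 //; last first.
    rewrite valueX => /eqP; rewrite expf_eq0 /= => s0.
    rewrite valueN valueM valueX oppr_eq0 mulf_neq0 ?dn0 ?expf_neq0 // cop //.
  rewrite valueX expf_eq0 /=; case: ifP => // _; congr Some.
  rewrite valueN valueM valueX value_dQ_apex // !mulNr.
  by rewrite -[_ * value z (dQ _) * _]mulrA canc.
rewrite rf_eval_to_ratfun; last 2 first.
- apply: mulf_neq0; last exact: expf_neq0.
  apply/eqP => d0; move: (dn0 (path_edge w).1).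
  by rewrite d0 /value rmorph0 horner0 eqxx.
- rewrite valueM valueX => /eqP; rewrite mulf_eq0 (negPf (dn0 _)) expf_eq0 /=.
  move=> y0; rewrite valueN valueX oppr_eq0 expf_neq0 // cop //.
rewrite valueM valueX mulf_eq0 (negPf (dn0 _)) expf_eq0 /=.
case: ifP => // _; congr Some.
rewrite valueN valueX value_dQ_apex // !mulNr.
rewrite [value z (dQ _) * value z (dQ _)]mulrC.
by rewrite -[value z (dQ _) * value z (dQ _) * _]mulrA canc.
Qed.

Lemma rf_eval_shape_eq1 (R : realType) (Q : option rat -> {poly int})
    (hQ : is_fareyQ Q) (z : R[i]) (t : bool) (w : seq bool) : z != 0 ->
  let e := path_edge (t :: w) in
  value z (dQ (Some e.1)) * value z (Q (Some e.2)) ^+ 2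
    + value z (dQ (Some e.2)) * value z (Q (Some e.1)) ^+ 2 = 0 ->
  rf_eval (shape_param Q e) z = Some 1.
Proof.
move=> z0 e H; have dn0 r := value_dQ_neq0 r z0.
have y0 : value z (Q (Some e.2)) != 0.
  apply/eqP => y0; move/eqP: H; rewrite y0 expr0n mulr0 add0r mulf_eq0.
  rewrite (negPf (dn0 _)) expf_eq0 /= => /eqP.
  by move/(Q_neighbours_coprime hQ z0); rewrite -/e y0 eqxx.
rewrite rf_eval_shape // -/e (negPf y0); congr Some.
move/eqP: H; rewrite addrC addr_eq0 => /eqP ->; rewrite opprK divff //.
by rewrite mulf_neq0 ?dn0 ?expf_neq0.
Qed.

(** * Walks along a funnel *)

(** The recursion for [Q] in terms of the quantities of [local_state]: with
    [s = Q(c) / (x * y)], the new vertex [c] has [u(c) = u * v / s ^+ 2]. *)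
Definition step (F : fieldType) (t : bool) (st : F * F * F) : F * F * F :=
  let: (u, v, s) := st in
  if t then (u, u * v / s ^+ 2, 1 - u / s) else (u * v / s ^+ 2, v, 1 - v / s).

(** The reversal of direction: by the Markov equation [s] and [1 - s] are the
    two roots of [X ^+ 2 - X + u + v], one for each side of the edge. *)
Definition flip (F : fieldType) (st : F * F * F) : F * F * F :=
  let: (u, v, s) := st in (u, v, 1 - s).

Lemma step_flip_step (F : fieldType) (t : bool) (u v s : F) :
  u != 0 -> v != 0 -> s != 0 ->
  step t (flip (step t (u, v, s))) = flip (u, v, s).
Proof.
move=> u0 v0 s0; case: t; rewrite /= !subKr; congr (_, _, _);
  by field; rewrite ?u0 ?v0 ?s0.
Qed.

Definition local_state (Q : option rat -> {poly int}) (F : fieldType) (z : F)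
    (w : seq bool) : F * F * F :=
  let e := path_edge w in
  let x := value z (Q (Some e.1)) in let y := value z (Q (Some e.2)) in
  (value z (dQ (Some e.1)) / x ^+ 2, value z (dQ (Some e.2)) / y ^+ 2,
   value z (Q (Some (apex e))) / (x * y)).

Definition nonvanishing (Q : option rat -> {poly int}) (F : fieldType) (z : F)
    (w : seq bool) : bool :=
  (value z (Q (Some (path_edge w).1)) != 0)
  && (value z (Q (Some (path_edge w).2)) != 0).

Lemma local_state_nil (Q : option rat -> {poly int}) (hQ : is_fareyQ Q)
    (F : fieldType) (z : F) : local_state Q z [::] = (z, - z, 1).
Proof.
have [Q0 _ Q1 _] := hQ.
rewrite /local_state /= /apex Q_half // Q0 Q1 !value1 !value_dQ /=.
by rewrite !mulr1 !expr1n !divr1 !mul1r expr1 !mulN1r.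
Qed.

Lemma nonvanishing_nil (Q : option rat -> {poly int}) (hQ : is_fareyQ Q)
    (F : fieldType) (z : F) : nonvanishing Q z [::].
Proof.
by have [Q0 _ Q1 _] := hQ; rewrite /nonvanishing /= Q0 Q1 value1 oner_eq0.
Qed.

Lemma nonvanishing_cons (Q : option rat -> {poly int}) (F : fieldType) (z : F)
    (t : bool) (w : seq bool) :
  nonvanishing Q z w -> value z (Q (Some (apex (path_edge w)))) != 0 ->
  nonvanishing Q z (t :: w).
Proof.
by rewrite /nonvanishing /turn; case: t => /= /andP[x0 y0] ->; rewrite ?x0.
Qed.

Lemma nonvanishing_apex (Q : option rat -> {poly int}) (F : fieldType) (z : F)
    (t : bool) (w : seq bool) :
  nonvanishing Q z (t :: w) -> value z (Q (Some (apex (path_edge w)))) != 0.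
Proof. by rewrite /nonvanishing /turn; case: t => /= /andP[]. Qed.

Lemma local_state_cons (Q : option rat -> {poly int}) (hQ : is_fareyQ Q)
    (F : fieldType) (z : F) (t : bool) (w : seq bool) :
  nonvanishing Q z w -> value z (Q (Some (apex (path_edge w)))) != 0 ->
  local_state Q z (t :: w) = step t (local_state Q z w).
Proof.
case/andP=> x0 y0 s0; have he := is_edge_path w.
rewrite /local_state [path_edge (_ :: _)]/= value_Q_turn //.
rewrite /turn; case: t; rewrite /= -/(apex _) value_dQ_apex //;
  move: x0 y0 s0; set x := value z _; set y := value z _; set s := value z _;
  set p := value z _; set q := value z _ => x0 y0 s0;
  by congr (_, _, _); field; rewrite ?x0 ?y0 ?s0.
Qed.

Lemma local_state_neq0 (Q : option rat -> {poly int}) (F : fieldType) (z : F)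
    (w : seq bool) : z != 0 -> nonvanishing Q z w ->
  ((local_state Q z w).1.1 != 0) && ((local_state Q z w).1.2 != 0).
Proof.
move=> z0 /andP[x0 y0].
by rewrite !mulf_neq0 ?invr_eq0 ?expf_neq0 ?value_dQ_neq0.
Qed.

Lemma rf_eval_shape_nonvanishing (R : realType) (Q : option rat -> {poly int})
    (hQ : is_fareyQ Q) (z : R[i]) (t : bool) (w : seq bool) :
  z != 0 -> nonvanishing Q z (t :: w) ->
  rf_eval (shape_param Q (path_edge (t :: w))) z =
  Some (- ((local_state Q z (t :: w)).1.2 / (local_state Q z (t :: w)).1.1)).
Proof.
move=> z0 hl; case/andP: (hl) => x0 y0.
rewrite rf_eval_shape // (negPf y0); congr Some.
have p0 := value_dQ_neq0 (path_edge (t :: w)).1 z0.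
rewrite /local_state; move: x0 y0 p0; cbv zeta.
set x := value z _; set y := value z _; set p := value z _ => x0 y0 p0 /=.
by field; rewrite x0 y0 p0.
Qed.

(** The walk of [z] ends at [(z', -z', 0)], the flip of the start of the walk
    of [z']; from there on [step_flip_step] undoes the turns of [W] one after
    the other.  That [Q] does not vanish at [z'] along the way follows from the
    flipped third component being [u / s] or [v / s], with [u], [v] and [s]
    those of [z], hence nonzero. *)
Lemma local_state_reversal (Q : option rat -> {poly int}) (hQ : is_fareyQ Q)
    (F : fieldType) (z : F) (W : seq bool) :
  z != 0 -> (forall A B, W = A ++ B -> nonvanishing Q z B) ->
  value z (Q (Some (apex (path_edge W)))) = 0 ->
  let z' := (local_state Q z W).1.1 in
  forall A B, W = A ++ B ->
  nonvanishing Q z' (rev A) /\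
  local_state Q z' (rev A) = flip (local_state Q z B).
Proof.
move=> z0 hl s0 z'.
have hW : nonvanishing Q z W by apply: (hl [::]).
elim/last_ind=> [|A t IH] B WE.
  split; first exact: nonvanishing_nil.
  rewrite local_state_nil // -[B]/([::] ++ B) -WE.
  rewrite /z' /local_state /= s0 mul0r subr0; congr (_, _, _).
  have /= := value_markov hQ z W; rewrite s0 mulr0 expr0n add0r.
  case/andP: hW; set x := value z _; set y := value z _; set p := value z _.
  set q := value z _ => x0 y0 /eqP; rewrite addr_eq0 => /eqP M.
  apply/eqP; rewrite -mulNr eqr_div ?expf_neq0 // mulNr M opprK.
  by rewrite mulrC.
rewrite cat_rcons in WE; have [lA EA] := IH _ WE.
have lB : nonvanishing Q z B by apply: (hl (rcons A t)); rewrite cat_rcons.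
have lt : nonvanishing Q z (t :: B) by apply: hl WE.
have sB := nonvanishing_apex lt.
have /andP[u0 v0] := local_state_neq0 z0 lB.
rewrite local_state_cons // in EA.
have t0 : (local_state Q z B).2 != 0.
  by case/andP: lB => x0 y0; rewrite mulf_neq0 ?invr_neq0 ?mulf_neq0.
have sA : value z' (Q (Some (apex (path_edge (rev A))))) != 0.
  have : (local_state Q z' (rev A)).2 != 0.
    rewrite EA; case: (local_state Q z B) u0 v0 t0 => -[u v] s /= u0 v0 t0.
    by case: (t); rewrite /= subKr mulf_neq0 ?invr_eq0.
  by apply: contraNneq => s'0; rewrite /local_state /= s'0 mul0r.
rewrite rev_rcons; split; first exact: nonvanishing_cons.
rewrite local_state_cons // EA.
by case: (local_state Q z B) u0 v0 t0 => -[u v] s /= *; apply: step_flip_step.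
Qed.

(** The edges of the funnel other than the first and the last are the nonempty
    proper suffixes of [W]. *)
Lemma geometric_conditions_path (R : realType) (Q : option rat -> {poly int})
    (W : seq bool) (z : R[i]) : (0 < size W)%N ->
  geometric_conditions Q (apex (path_edge W)) z <->
  [/\ 0 < complex.Im z, value z (Q (Some (apex (path_edge W)))) = 0 &
      forall a A t B, W = a :: A ++ t :: B ->
        Im_pos (rf_eval (shape_param Q (path_edge (t :: B))) z)].
Proof.
move=> W0; split=> [[Iz /rootP rz [n hn Hz]] | [Iz rz Hz]].
  split=> // a A t B WE.
  have szW : n.+1 = size W by apply/(funnel_length_path _ W0).
  have szE : size W = ((size A).+1 + (size B).+1)%N.
    by rewrite WE /= size_cat.
  have := Hz (size B).+1; rewrite funnel_path; last by rewrite szE leq_addl.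
  rewrite szE addnK WE -cat_cons drop_size_cat //; apply.
  by rewrite /= -ltnS szW szE; lia.
split=> //; first exact/rootP.
exists (size W).-1; first by apply/(funnel_length_path _ W0); rewrite prednK.
move=> j /andP[j1 jW].
have jW' : (j <= size W)%N by lia.
rewrite funnel_path //; have := cat_take_drop (size W - j) W.
have := size_takel (leq_subr j (size W)); have := size_drop (size W - j) W.
case: (take _ _) => [|a A] /=; first by lia.
case: (drop _ _) => [|t B] /=; first by lia.
by move=> _ _ /esym; apply: Hz.
Qed.

(** A shape parameter with positive imaginary part is neither [0] nor [oo];
    at the last edge both endpoints are neighbours of the zero [alpha]. *)
Lemma geometric_nonvanishing (R : realType) (Q : option rat -> {poly int})
    (hQ : is_fareyQ Q) (W : seq bool) (z : R[i]) : (0 < size W)%N ->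
  geometric_conditions Q (apex (path_edge W)) z ->
  forall A B, W = A ++ B -> nonvanishing Q z B.
Proof.
move=> W0 /(geometric_conditions_path _ _ W0)[Iz rz Hz] A B WE.
have z0 : z != 0 by apply: contraTneq Iz => ->; rewrite ltxx.
case: B WE => [|t B] WE; first exact: nonvanishing_nil.
case: A WE => [/= <- | a A WE].
  apply/andP; split.
    apply/eqP => x0.
    have /eqP := @Q_neighbours_coprime _ hQ _ z (true :: W) z0 x0.
    by apply.
  exact: (@Q_neighbours_coprime _ hQ _ z (false :: W) z0 rz).
have := Hz _ _ _ _ WE; rewrite rf_eval_shape //.
case: eqP => // /eqP y0; rewrite /nonvanishing y0 andbT => I.
by apply: contraTneq I => ->; rewrite expr0n /= mulr0 oppr0 mul0r ltxx.
Qed.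

(** The shape parameters at [z'] are those at [z] in the opposite order.  The
    first turn of [W] is [true], that is, [alpha < 1/2], and the shape parameter
    after this turn is the variable itself; so the condition at that edge says
    that [z'] has positive imaginary part. *)
Lemma geometric_conditions_reversal (R : realType)
    (Q : option rat -> {poly int}) (hQ : is_fareyQ Q) (a : bool)
    (A : seq bool) (z : R[i]) :
  let W := a :: A ++ [:: true] in rev W = W ->
  geometric_conditions Q (apex (path_edge W)) z ->
  geometric_conditions Q (apex (path_edge W)) (local_state Q z W).1.1.
Proof.
move=> W revW gz; set z' := (local_state Q z W).1.1.
have lz := geometric_nonvanishing hQ (isT : (0 < size W)%N) gz.
case/(@geometric_conditions_path R Q W z isT): (gz) => Iz rz Hz.
have z0 : z != 0 by apply: contraTneq Iz => ->; rewrite ltxx.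
have /andP[z'0 _] := local_state_neq0 z0 (lz [::] W erefl).
have Hrev := local_state_reversal hQ z0 lz rz; rewrite -/z' in Hrev z'0.
have Hz' b C t B : W = b :: C ++ t :: B ->
    Im_pos (rf_eval (shape_param Q (path_edge (t :: B))) z').
  move=> WE; have WE' : W = rev (t :: B) ++ rev (b :: C).
    by rewrite -rev_cat cat_cons -WE revW.
  have [lt Et] := Hrev _ _ WE'; rewrite revK in lt Et.
  rewrite rf_eval_shape_nonvanishing // Et.
  have := lz _ _ WE'.
  case Eb: (rev (b :: C)) WE' => [|t2 B2].
    by move/(congr1 size): Eb; rewrite size_rev.
  case Ea: (rev (t :: B)) => [|a2 A2] WE'.
    by move/(congr1 size): Ea; rewrite size_rev.
  move=> l2; have := Hz _ _ _ _ WE'.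
  by rewrite rf_eval_shape_nonvanishing.
apply/(@geometric_conditions_path R Q W z' isT); split=> //.
  have := Hz' a A true [::] erefl.
  have l1 : nonvanishing Q z' [:: true].
    apply: nonvanishing_cons; first exact: nonvanishing_nil.
    by rewrite /apex /= Q_half // value1 oner_eq0.
  rewrite rf_eval_shape_nonvanishing // local_state_cons //;
    last exact: nonvanishing_apex l1.
    rewrite local_state_nil //= expr1n divr1 mulrN mulNr opprK.
    by rewrite -mulrA divff // mulr1.
  exact: nonvanishing_nil.
have WE : W = W ++ [::] by rewrite cats0.
have [/andP[x0 y0] E] := Hrev _ _ WE; rewrite revW in x0 y0 E.
have : (local_state Q z' W).2 = 0 by rewrite E local_state_nil //= subrr.
rewrite /local_state /= => /eqP; rewrite mulf_eq0 invr_eq0 mulf_eq0.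
by rewrite (negPf x0) (negPf y0) /= orbF => /eqP.
Qed.

(** * The symmetry at the geometric root *)

(** Uniqueness gives [z' = z], so the states before and after the middle turn
    are flips of each other; their components that differ by the middle turn
    are [u(e^-)] and [u(e^+)]. *)
Lemma shape_at_geometric_root (R : realType) (Q : option rat -> {poly int})
    (hQ : is_fareyQ Q) (t : bool) (w : seq bool) (z : R[i]) :
  is_geometric_root Q
    (apex (path_edge (palindrome_through t (rcons w true)))) z ->
  rf_eval (shape_param Q (path_edge (t :: rcons w true))) z = Some (-1).
Proof.
set v := rcons w true; have revW := palindrome_throughK t v.
have WE : palindrome_through t v
    = true :: (rev w ++ ~~ t :: w) ++ [:: true].
  by rewrite /palindrome_through /v rev_rcons -cats1 -catA.
rewrite WE in revW *; set W := (X in path_edge X) in revW * => -[gz uniq_z].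
have lz := geometric_nonvanishing hQ (isT : (0 < size W)%N) gz.
case/(@geometric_conditions_path R Q W z isT): (gz) => Iz rz _.
have z0 : z != 0 by apply: contraTneq Iz => ->; rewrite ltxx.
have zE : z = (local_state Q z W).1.1.
  exact: uniq_z (geometric_conditions_reversal hQ revW gz).
have := local_state_reversal hQ z0 lz rz; rewrite -zE => Hrev.
have WE' : W = rev v ++ ~~ t :: v := esym WE.
have [lv] := Hrev _ _ WE'; rewrite revK in lv *.
have sv := nonvanishing_apex (lz _ _ WE').
rewrite local_state_cons // rf_eval_shape_nonvanishing ?nonvanishing_cons //.
rewrite local_state_cons //.
have /andP[] := local_state_neq0 z0 lv.
case: (local_state Q z v) => -[u1 u2] s /= n1 n2; case: (t) => /= -[] E _;
  by rewrite -E divff.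
Qed.

Theorem theorem7p8 (R : realType) (Q : option rat -> {poly int})
    (hQ : is_fareyQ Q)
    (e : rat * rat) (he : is_edge e) (hne : e <> horizontal) :
  [/\ forall a : R[i], is_root (Q (Some e.1)) a ->
        rf_eval (shape_param Q e) a = Some 0,
      forall b : R[i], is_root (Q (Some e.2)) b ->
        rf_eval (shape_param Q e) b = None,
      forall c : R[i], is_root (Q (Some (ehat e))) c ->
        rf_eval (shape_param Q e) c = Some 1,
      forall d : R[i],
        is_root (Q (oplus (Some (eminus e)) (Some (eplus e)))) d ->
        rf_eval (shape_param Q e) d = Some 1 &
      forall alpha : rat,
        alpha = (numq e.2 * denq e.2 - numq e.1 * denq e.1)%:Q
                / (denq e.2 ^+ 2 - denq e.1 ^+ 2)%:Q ->
        0 < alpha < 1 / 2 -> alpha^-1 \isn't a Num.int ->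
        forall z : R[i], is_geometric_root Q alpha z ->
          rf_eval (shape_param Q e) z = Some (-1)].
Proof.
have [[|t w] eE] := path_edge_surj he; first by case: hne.
have hw := is_edge_path w.
have [v1 v2 v3] := value0_Q hQ R[i] (t :: w); rewrite -eE in v1 v2 v3.
have [w1 w2 _] := value0_Q hQ R[i] w.
have root_neq0 r (z : R[i]) : value 0 (Q (Some r)) = 1 :> R[i] ->
    value z (Q (Some r)) = 0 -> z != 0.
  move=> v rz; apply: contra_eq_neq rz => ->.
  by rewrite v oner_eq0.
have apexE : oplus (Some (eminus e)) (Some (eplus e)) = Some (apex e).
  rewrite oplus_Some /eminus /eplus /apex; case: ifP => // _.
  by rewrite mediantC.
split.
- move=> a /rootP; rewrite -/(value a _) => ra; have a0 := root_neq0 _ _ v1 ra.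
  have y0 : value a (Q (Some e.2)) != 0.
    by move: ra; rewrite eE; apply: Q_neighbours_coprime.
  rewrite eE rf_eval_shape // -eE (negPf y0); congr Some.
  by rewrite ra expr0n mulr0 oppr0 mul0r.
- move=> b /rootP; rewrite -/(value b _) => rb; have b0 := root_neq0 _ _ v2 rb.
  by rewrite eE rf_eval_shape // -eE rb eqxx.
- move=> c /rootP; rewrite -/(value c _) eE ehat_turn // => rc.
  have c0 : c != 0 by case: (t) rc; apply: root_neq0.
  rewrite rf_eval_shape_eq1 //; have := value_markov hQ c w.
  case: t {eE} rc => /= rc; rewrite /= -/(apex _) value_dQ_apex // rc => M.
    rewrite -mulrA -mulrDr.
    by rewrite mulr0 mul0r expr0n mulr0 addr0 in M; rewrite M mulr0.
  rewrite [value c (dQ _) * value c (dQ _)]mulrC -mulrA -mulrDr addrC.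
  by rewrite !mul0r expr0n mulr0 addr0 in M; rewrite M mulr0.
- move=> d /rootP; rewrite apexE -/(value d _) => rd.
  have d0 := root_neq0 _ _ v3 rd.
  rewrite eE rf_eval_shape_eq1 //; have := value_markov hQ d (t :: w).
  by rewrite -eE /= rd mulr0 expr0n add0r.
move=> alpha; rewrite eE -apex_palindrome => -> a12 aint z.
(* The excluded values: without turns before the middle one, [alpha] is [2/3]
   or [1/3]. *)
case: (lastP w) a12 aint => [|w' b].
  case: (t).
    have -> : apex (path_edge (palindrome_through true [::])) = 2 / 3.
      exact/eqP.
    by case/andP.
  have -> : apex (path_edge (palindrome_through false [::])) = 3^-1.
    exact/eqP.
  by rewrite invrK natr_int.
case: b => [_ _|]; first exact: shape_at_geometric_root.
(* A first turn [false] would keep the path to the right of [1/2]. *)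
set W := palindrome_through _ _ => /andP[_ aW] _ _.
have [v WE] : exists v, W = v ++ [:: false].
  exists (rev (rcons w' false) ++ ~~ t :: w').
  by rewrite /W /palindrome_through -catA cats1.
have [lw _] := foldr_turn_within v (is_edge_path [:: false]).
have /andP[la _] := mediant_between (is_edge_path W).
have EW : path_edge W = foldr turn (path_edge [:: false]) v.
  by rewrite WE /path_edge foldr_cat.
rewrite -EW in lw.
by have := lt_trans (le_lt_trans lw la) aW; rewrite ltxx.
Qed.
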